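(* Let $q>0$, $q\neq 1$, and let $m$ be a positive integer. For every fixed $c$ with $0<c<1$, the function $x\mapsto G_m(x;q,c)$ is completely monotonic on $(0,\infty)$. Moreover, when $m=1$ or $m=2$, for every fixed $c>1$ the function $x\mapsto -G_m(x;q,c)$ is completely monotonic on $(0,\infty)$.
   Context: A function $f$ is completely monotonic on an interval $(a,b)$ if it has derivatives of all orders there and $(-1)^k f^{(k)}(x)\ge 0$ for all $x\in(a,b)$ and all integers $k\ge 0$. For $x>0$ and $q>0$, $q\ne 1$, the $q$-gamma function is $$\Gamma_q(x)=(1-q)^{1-x}\prod_{n=0}^{\infty}\frac{1-q^{n+1}}{1-q^{n+x}}\quad (0<q<1),$$ $$\Gamma_q(x)=(q-1)^{1-x}q^{\frac12 x(x-1)}\prod_{n=0}^{\infty}\frac{1-q^{-(n+1)}}{1-q^{-(n+x)}}\quad (q>1).$$ Let $\psi_q(x)=\frac{d}{dx}\ln\Gamma_q(x)$ be its logarithmic derivative, and let $\psi_q^{(k)}$ ($k\ge 1$) be its $k$-th derivative; set $\psi_q^{(0)}=\psi_q$ and, by convention, $\psi_q^{(-1)}(x)=-x$. For a function $f$ and real $c\ne 0$ write $\Delta f(x;c)=\dfrac{f(x+c)-f(x)}{c}$. For positive integers $r,m,n,s$ let $\alpha_{r,m,n,s}=\dfrac{(m-1)!(n-1)!}{(r-1)!(s-1)!}$, and for $s=0$ let $\alpha_{r,m,n,0}=\dfrac{(m-1)!(n-1)!}{(r-1)!}$. For integers $r\ge m\ge n\ge s\ge 0$ with $n\ge 1$ define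 $$F_{r,m,n,s}(x;q,c)=(-1)^{m+n}\Delta\psi_q^{(m-1)}(x;c)\,\Delta\psi_q^{(n-1)}(x;c)-\alpha_{r,m,n,s}(-1)^{r+s}\Delta\psi_q^{(r-1)}(x;c)\,\Delta\psi_q^{(s-1)}(x;c).$$ For integers $m\ge 1$ define $$G_m(x;q,c)=m\,F_{m+1,m,1,0}(x;q,c)-(-1)^{m+1}d_{m,q}\,\ln q\cdot\Delta\psi_q^{(m-1)}(x;c),$$ where $d_{m,q}=m-1$ if $0<q<1$ and $m\ge 2$, and $d_{m,q}=1$ if $q>1$ (any $m\geq 1$) or if $0<q<1$ and $m=1$. *)

(* Defs.v *)
(* Real analysis over the standard library's R, with Coquelicot's total
   operators for limits and derivatives. *)
From Stdlib Require Export Reals Arith.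
From Coquelicot Require Export Coquelicot.

Open Scope R_scope.

Definition completely_monotonic (a b : Rbar) (f : R -> R) : Prop :=
  forall (k : nat) (x : R), Rbar_lt a x -> Rbar_lt x b ->
    ex_derive_n f k x /\ 0 <= (-1) ^ k * Derive_n f k x.

Definition infinite_product (a : nat -> R) : R :=
  real (Lim_seq (prod_f_R0 a)).

(* Meaningful for x > 0, q > 0, q <> 1 only. *)
Definition q_gamma (q x : R) : R :=
  if Rlt_dec q 1 then
    Rpower (1 - q) (1 - x) *
    infinite_product (fun n =>
      (1 - Rpower q (INR n + 1)) / (1 - Rpower q (INR n + x)))
  else
    Rpower (q - 1) (1 - x) * Rpower q (1 / 2 * x * (x - 1)) *
    infinite_product (fun n =>
      (1 - Rpower q (- (INR n + 1))) / (1 - Rpower q (- (INR n + x)))).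

Definition psi (q : R) : R -> R := Derive (fun x => ln (q_gamma q x)).

(* [psi_pred q k] is the derivative of [psi q] of order k - 1: the index is
   shifted by one so that the convention psi^(-1) (x) = - x is the case k = 0. *)
Definition psi_pred (q : R) (k : nat) : R -> R :=
  match k with
  | O => fun x => - x
  | S j => Derive_n (psi q) j
  end.

Definition Delta (f : R -> R) (x c : R) : R := (f (x + c) - f x) / c.

(* Used for r, m, n >= 1 only, where [pred] is the usual subtraction of 1. *)
Definition alpha (r m n s : nat) : R :=
  match s with
  | O => INR (fact (pred m)) * INR (fact (pred n)) / INR (fact (pred r))
  | S s' => INR (fact (pred m)) * INR (fact (pred n)) /
            (INR (fact (pred r)) * INR (fact s'))
  end.

Definition F (r m n s : nat) (x q c : R) : R :=
  (-1) ^ (m + n) * Delta (psi_pred q m) x c * Delta (psi_pred q n) x c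
  - alpha r m n s * (-1) ^ (r + s) *
    Delta (psi_pred q r) x c * Delta (psi_pred q s) x c.

Definition d (m : nat) (q : R) : R :=
  if Rlt_dec q 1 then
    if le_dec 2 m then INR m - 1 else 1
  else 1.

Definition G (m : nat) (x q c : R) : R :=
  INR m * F (m + 1) m 1 0 x q c
  - (-1) ^ (m + 1) * d m q * ln q * Delta (psi_pred q m) x c.

(* Main.v *)
(** With [p = min (q, 1 / q)], [L = - ln p] and
    [S(z) = sum_(n >= 1) z ^ n / (n (1 - p ^ n))] one has
    [S(z) - S(p z) = - ln (1 - z)], so the product defining the q-gamma function
    telescopes to [exp (S(p ^ x) - S(p))].  Hence [G_m] is a power series in [p ^ x],
    and it is completely monotonic as soon as its coefficients are nonnegative.
    With [w_n = (1 - p ^ (c n)) / (1 - p ^ n)], the [N]-th coefficient is a positive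
    multiple of
    [(m / c) sum_(0 < i < N) i ^ (m-1) w_i w_(N-i) - N ^ (m-1) (N - max (1, m-1)) w_N].
    Since [u coth (u / 2)] increases, [w_i w_j >= c w_(i+j)] for [c <= 1], and [<=] for
    [c >= 1]; it remains to compare [m sum_(i < N) i ^ (m-1)] with
    [N ^ (m-1) (N - max (1, m-1))]: the former is larger by Bernoulli's inequality,
    with equality when [m <= 2]. *)
From Stdlib Require Import Lra Lia.
Require Import Defs.

(** * Power series converging on the open unit disk *)

Definition unit_disk (a : nat -> R) : Prop :=
  forall z : R, Rabs z < 1 -> ex_pseries a z.

(** If the radius were at most |z|, the midpoint of |z| and 1 would lie beyond it, where the terms
    cannot tend to 0. *)
Lemma unit_disk_lt_radius (a : nat -> R) (z : R) :
  unit_disk a -> Rabs z < 1 -> Rbar_lt (Rabs z) (CV_radius a).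
Proof.
  intros Ha Hz.
  destruct (Rbar_le_lt_dec (CV_radius a) (Rabs z)) as [H|H]; [exfalso|exact H].
  assert (Hy : Rabs ((Rabs z + 1) / 2) = (Rabs z + 1) / 2).
  { apply Rabs_pos_eq. generalize (Rabs_pos z). lra. }
  apply (CV_disk_outside a ((Rabs z + 1) / 2)).
  - apply Rbar_le_lt_trans with (1 := H). rewrite Hy. simpl. lra.
  - apply ex_series_lim_0, ex_pseries_R, Ha. rewrite Hy. lra.
Qed.

Lemma unit_disk_bounded (a : nat -> R) (M : R) :
  (forall n, Rabs (a n) <= M) -> unit_disk a.
Proof.
  intros H z Hz. apply CV_radius_inside.
  apply Rbar_lt_le_trans with 1; [exact Hz|].
  apply (proj1 (CV_radius_bounded a)).
  exists M. intros n. rewrite pow1, Rmult_1_r. apply H.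
Qed.

Lemma unit_disk_ext (a b : nat -> R) :
  (forall n, a n = b n) -> unit_disk a -> unit_disk b.
Proof. intros E H z Hz. apply ex_pseries_ext with a; auto. Qed.

Lemma unit_disk_mult (a b : nat -> R) :
  unit_disk a -> unit_disk b -> unit_disk (PS_mult a b).
Proof.
  intros Ha Hb z Hz.
  apply ex_pseries_mult; apply unit_disk_lt_radius; assumption.
Qed.

Lemma unit_disk_plus (a b : nat -> R) :
  unit_disk a -> unit_disk b -> unit_disk (PS_plus a b).
Proof. intros Ha Hb z Hz. apply ex_pseries_plus; auto. Qed.

Lemma unit_disk_scal (r : R) (a : nat -> R) :
  unit_disk a -> unit_disk (PS_scal r a).
Proof.
  intros Ha z Hz. apply (ex_pseries_scal (K := R_AbsRing)); [|auto].
  unfold mult; simpl. apply Rmult_comm.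
Qed.

(** Multiplication by the index is the operator z d/dz; writing it with [PS_incr_1] and [PS_derive]
    gives its radius and its link to derivatives. *)
Lemma mul_index_incr_derive (a : nat -> R) (n : nat) :
  PS_incr_1 (PS_derive a) n = INR n * a n.
Proof.
  destruct n as [|n]; [|reflexivity].
  simpl. unfold zero; simpl. ring.
Qed.

Lemma unit_disk_mul_index (a : nat -> R) :
  unit_disk a -> unit_disk (fun n => INR n * a n).
Proof.
  intros Ha z Hz. apply CV_radius_inside.
  rewrite <- (CV_radius_ext _ _ (mul_index_incr_derive a)).
  rewrite CV_radius_incr_1, CV_radius_derive.
  apply unit_disk_lt_radius; assumption.
Qed.

Lemma unit_disk_mul_index_pow (a : nat -> R) (j : nat) :
  unit_disk a -> unit_disk (fun n => INR n ^ j * a n).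
Proof.
  intros Ha. induction j as [|j IH].
  - apply unit_disk_ext with a; [intros n; simpl; ring | exact Ha].
  - apply unit_disk_ext with (fun n => INR n * (INR n ^ j * a n)).
    + intros n; simpl; ring.
    + apply unit_disk_mul_index, IH.
Qed.

(** * Series in p^x: derivatives and complete monotonicity *)

Lemma Rpower_lt_1 (p x : R) : 0 < p < 1 -> 0 < x -> 0 < Rpower p x < 1.
Proof.
  intros Hp Hx. unfold Rpower. split; [apply exp_pos|].
  rewrite <- exp_0. apply exp_increasing.
  assert (ln p < 0) by (rewrite <- ln_1; apply ln_increasing; lra). nra.
Qed.

Lemma Rabs_Rpower_lt_1 (p x : R) : 0 < p < 1 -> 0 < x -> Rabs (Rpower p x) < 1.
Proof.
  intros Hp Hx. destruct (Rpower_lt_1 p x Hp Hx). rewrite Rabs_pos_eq; lra.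
Qed.

Lemma PSeries_mul_var (a : nat -> R) (t z : R) :
  PSeries a (t * z) = PSeries (fun n => t ^ n * a n) z.
Proof. apply Series_ext. intros n. rewrite Rpow_mult_distr. ring. Qed.

Lemma is_derive_PSeries_Rpower (a : nat -> R) (p x : R) :
  unit_disk a -> 0 < p < 1 -> 0 < x ->
  is_derive (fun y => PSeries a (Rpower p y)) x
    (ln p * PSeries (fun n => INR n * a n) (Rpower p x)).
Proof.
  intros Ha Hp Hx.
  rewrite <- (PSeries_ext _ _ _ (mul_index_incr_derive a)), PSeries_incr_1.
  replace (ln p * (Rpower p x * PSeries (PS_derive a) (Rpower p x)))
    with (scal (ln p * Rpower p x) (PSeries (PS_derive a) (Rpower p x)))
    by (unfold scal; simpl; unfold mult; simpl; ring).
  apply (is_derive_comp (PSeries a) (Rpower p)).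
  - apply is_derive_PSeries, unit_disk_lt_radius; [exact Ha|].
    now apply Rabs_Rpower_lt_1.
  - unfold Rpower. auto_derive; [exact I|ring].
Qed.

Lemma locally_pos (x : R) (P : R -> Prop) :
  0 < x -> (forall y, 0 < y -> P y) -> locally x P.
Proof.
  intros Hx H. apply (filter_imp (fun y => 0 < y)); [exact H|].
  apply (open_gt 0). exact Hx.
Qed.

(** Each derivative in x brings out a factor ln p and multiplies the n-th coefficient by n. *)
Lemma Derive_n_PSeries_Rpower (f : R -> R) (a : nat -> R) (p : R) (k : nat) :
  unit_disk a -> 0 < p < 1 ->
  (forall x, 0 < x -> f x = PSeries a (Rpower p x)) ->
  forall x, 0 < x ->
    ex_derive_n f k x /\
    Derive_n f k x = ln p ^ k * PSeries (fun n => INR n ^ k * a n) (Rpower p x).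
Proof.
  intros Ha Hp Hf. induction k as [|k IH]; intros x Hx.
  - split; [exact I|]. simpl. rewrite (Hf x Hx), Rmult_1_l.
    apply PSeries_ext. intros n. ring.
  - assert (D : is_derive (Derive_n f k) x (ln p ^ S k *
       PSeries (fun n => INR n ^ S k * a n) (Rpower p x))).
    (* The induction hypothesis covers positive arguments only, so the series replaces the k-th
       derivative just near x. *)
    { apply is_derive_ext_loc with (fun y =>
        ln p ^ k * PSeries (fun n => INR n ^ k * a n) (Rpower p y)).
      - apply locally_pos; [exact Hx|]. intros y Hy. symmetry. apply (IH y Hy).
      - rewrite (PSeries_ext _ (fun n => INR n * (INR n ^ k * a n)))
          by (intros n; simpl; ring).
        replace (ln p ^ S k) with (ln p ^ k * ln p) by (simpl; ring).
        rewrite Rmult_assoc. apply is_derive_scal.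
        apply is_derive_PSeries_Rpower; [|exact Hp|exact Hx].
        now apply unit_disk_mul_index_pow. }
    split; [exists (ln p ^ S k *
       PSeries (fun n => INR n ^ S k * a n) (Rpower p x)); exact D|].
    simpl Derive_n. now apply is_derive_unique.
Qed.

Lemma PSeries_nonneg (a : nat -> R) (z : R) :
  (forall n, 0 <= a n) -> 0 <= z -> ex_pseries a z -> 0 <= PSeries a z.
Proof.
  intros Ha Hz Hex. unfold PSeries.
  (* Zero becomes a series of zero terms, written [0 * 0] so that [Series_scal_l] evaluates it. *)
  replace 0 with (Series (fun n : nat => 0 * 0)).
  2: { rewrite Series_scal_l. ring. }
  apply Series_le.
  - intros n. split; [lra|]. rewrite Rmult_0_l.
    apply Rmult_le_pos; [apply Ha|now apply pow_le].
  - now apply ex_pseries_R.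
Qed.

(** The sign (-1)^k and (ln p)^k combine into (- ln p)^k >= 0, and the factors n^k keep the
    coefficients nonnegative. *)
Lemma completely_monotonic_PSeries_Rpower (f : R -> R) (a : nat -> R) (p : R) :
  unit_disk a -> 0 < p < 1 -> (forall n, 0 <= a n) ->
  (forall x, 0 < x -> f x = PSeries a (Rpower p x)) ->
  completely_monotonic 0 p_infty f.
Proof.
  intros Ha Hp Hpos Hf k x Hx _. simpl in Hx.
  destruct (Derive_n_PSeries_Rpower f a p k Ha Hp Hf x Hx) as [E ->].
  split; [exact E|].
  rewrite <- Rmult_assoc, <- Rpow_mult_distr.
  assert (ln p < 0) by (rewrite <- ln_1; apply ln_increasing; lra).
  apply Rmult_le_pos; [apply pow_le; lra|].
  apply PSeries_nonneg.
  - intros n. apply Rmult_le_pos; [apply pow_le, pos_INR|apply Hpos].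
  - apply Rlt_le, exp_pos.
  - apply (unit_disk_mul_index_pow a k Ha). now apply Rabs_Rpower_lt_1.
Qed.

(** * Monotonicity of u coth (u / 2) and the inequality for q-ratios *)

(* [sinh u >= u], multiplied by [2 exp (- u)]. *)
Lemma sinh_ge_id_exp (u : R) : 0 <= u -> 0 <= 1 - exp (-2 * u) - 2 * u * exp (- u).
Proof.
  intros Hu.
  set (f := fun y => 1 - exp (-2 * y) - 2 * y * exp (- y)).
  (* As [f 0 = 0], a nonnegative derivative suffices; its sign comes from exp (-y) >= 1 - y. *)
  destruct (MVT_gen f 0 u
    (fun y => 2 * exp (- y) * (exp (- y) - 1 + y))) as [y [Hy E]].
  - intros y _. unfold f. auto_derive; [exact I|].
    replace (-2 * y) with (- y + - y) by ring. rewrite exp_plus. ring.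
  - intros y _. apply derivable_continuous_pt, ex_derive_Reals_0.
    unfold f. auto_derive. exact I.
  - rewrite Rmin_left in Hy by lra.
    assert (E0 : f 0 = 0).
    { unfold f. replace (-2 * 0) with 0 by ring. rewrite Ropp_0, exp_0. ring. }
    change (0 <= f u).
    assert (0 <= 2 * exp (- y) * (exp (- y) - 1 + y) * (u - 0)); [|lra].
    apply Rmult_le_pos; [|lra].
    generalize (exp_ineq1_le (- y)) (exp_pos (- y)). intros. nra.
Qed.

(* [u coth (u / 2)]. *)
Definition coth_mul (u : R) : R := u * (1 + exp (- u)) / (1 - exp (- u)).

Lemma exp_neg_lt_1 (u : R) : 0 < u -> exp (- u) < 1.
Proof. intros H. rewrite <- exp_0. apply exp_increasing. lra. Qed.

(** The numerator of the derivative is the expression of [sinh_ge_id_exp]. *)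
Lemma coth_mul_le (u v : R) : 0 < u <= v -> coth_mul u <= coth_mul v.
Proof.
  intros [Hu Hv].
  destruct (MVT_gen coth_mul u v (fun y =>
    (1 - exp (-2 * y) - 2 * y * exp (- y)) / (1 - exp (- y)) ^ 2)) as [y [Hy E]].
  - rewrite Rmin_left, Rmax_right by lra.
    intros y Hy. generalize (exp_neg_lt_1 y ltac:(lra)); intros He.
    unfold coth_mul. auto_derive; [lra|].
    replace (-2 * y) with (- y + - y) by ring. rewrite exp_plus. field. lra.
  - rewrite Rmin_left, Rmax_right by lra.
    intros y Hy. generalize (exp_neg_lt_1 y ltac:(lra)); intros He.
    apply derivable_continuous_pt, ex_derive_Reals_0.
    unfold coth_mul. auto_derive. lra.
  - rewrite Rmin_left, Rmax_right in Hy by lra.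
    generalize (exp_neg_lt_1 y ltac:(lra)) (sinh_ge_id_exp y ltac:(lra)); intros He Hs.
    assert (0 <= (1 - exp (-2 * y) - 2 * y * exp (- y)) / (1 - exp (- y)) ^ 2 * (v - u));
      [|lra].
    apply Rmult_le_pos; [|lra].
    apply Rmult_le_pos; [exact Hs|].
    apply Rlt_le, Rinv_0_lt_compat, pow_lt. lra.
Qed.

(* [coth (u / 2)] at [a = exp (- u)]. *)
Definition phi (a : R) : R := (1 + a) / (1 - a).

Lemma phi_coth_mul (a : R) : 0 < a < 1 -> phi a = coth_mul (- ln a) / (- ln a).
Proof.
  intros Ha. assert (ln a < 0) by (rewrite <- ln_1; apply ln_increasing; lra).
  unfold phi, coth_mul. rewrite Ropp_involutive, exp_ln by lra. field. lra.
Qed.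

(** With u = - ln a, both sides are values of [coth_mul] divided by u, at c u and at u; monotonicity
    decides according to whether c is below or above 1. *)
Lemma phi_Rpower (a c : R) : 0 < a < 1 -> 0 < c ->
  (c <= 1 -> c * phi (Rpower a c) <= phi a) /\
  (1 <= c -> phi a <= c * phi (Rpower a c)).
Proof.
  intros Ha Hc.
  assert (Hl : ln a < 0) by (rewrite <- ln_1; apply ln_increasing; lra).
  rewrite !phi_coth_mul by (try apply Rpower_lt_1; lra).
  rewrite ln_Rpower.
  replace (c * (coth_mul (- (c * ln a)) / - (c * ln a)))
    with (coth_mul (- (c * ln a)) / - ln a) by (field; lra).
  assert (0 < / - ln a) by (apply Rinv_0_lt_compat; lra).
  split; intros Hc1; apply Rmult_le_compat_r; try lra; apply coth_mul_le; nra.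
Qed.

(* [(1 - a b) / ((1 - a) (1 - b)) = (phi a + phi b) / 2] separates the variables. *)
Lemma quotient_mul (a b : R) : 0 < a < 1 -> 0 < b < 1 ->
  1 - a * b = (phi a + phi b) / 2 * ((1 - a) * (1 - b)).
Proof. intros Ha Hb. unfold phi. field. lra. Qed.

(** By [quotient_mul], w (a b) is w a w b times (phi A + phi B) / (phi a + phi b) with A = a^c, B =
    b^c; [phi_Rpower] compares c times this quotient with 1. *)
Lemma q_ratio_mul (a b c : R) : 0 < a < 1 -> 0 < b < 1 -> 0 < c ->
  let w y := (1 - Rpower y c) / (1 - y) in
  (c <= 1 -> c * w (a * b) <= w a * w b) /\
  (1 <= c -> w a * w b <= c * w (a * b)).
Proof.
  intros Ha Hb Hc w. unfold w. rewrite <- Rpower_mult_distr by lra.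
  destruct (Rpower_lt_1 a c Ha Hc) as [A0 A1], (Rpower_lt_1 b c Hb Hc) as [B0 B1].
  destruct (phi_Rpower a c Ha Hc) as [Pa Qa], (phi_Rpower b c Hb Hc) as [Pb Qb].
  set (A := Rpower a c) in *. set (B := Rpower b c) in *.
  assert (Pos : forall y, 0 < y < 1 -> 0 < phi y).
  { intros y Hy. unfold phi. apply Rdiv_lt_0_compat; lra. }
  generalize (Pos a Ha) (Pos b Hb); intros fa fb.
  rewrite (quotient_mul A B), (quotient_mul a b) by lra.
  replace (c * ((phi A + phi B) / 2 * ((1 - A) * (1 - B)) /
                ((phi a + phi b) / 2 * ((1 - a) * (1 - b)))))
    with ((1 - A) / (1 - a) * ((1 - B) / (1 - b)) *
          ((c * phi A + c * phi B) / (phi a + phi b))) by (field; lra).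
  assert (0 < (1 - A) / (1 - a) * ((1 - B) / (1 - b))).
  { apply Rmult_lt_0_compat; apply Rdiv_lt_0_compat; lra. }
  set (M := (1 - A) / (1 - a) * ((1 - B) / (1 - b))) in *.
  split; intros Hc1.
  - apply Rle_trans with (M * 1); [|lra]. apply Rmult_le_compat_l; [lra|].
    apply Rle_div_l; [lra|]. generalize (Pa Hc1) (Pb Hc1). lra.
  - apply Rle_trans with (M * 1); [lra|]. apply Rmult_le_compat_l; [lra|].
    apply Rle_div_r; [lra|]. generalize (Qa Hc1) (Qb Hc1). lra.
Qed.

(** * Coefficients of psi and of its differences *)

Definition psi_coef (p : R) (n : nat) : R :=
  match n with O => 0 | S _ => / (1 - p ^ n) end.

(** The w_n of the overview, with w_0 = 0: the series of psi at x minus the one at x + c. *)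
Definition delta_coef (p c : R) (n : nat) : R :=
  (1 - Rpower p c ^ n) * psi_coef p n.

Lemma pow_S_lt_1 (p : R) (n : nat) : 0 < p < 1 -> 0 < p ^ S n <= p.
Proof.
  intros Hp. split; [apply pow_lt; lra|].
  assert (p ^ n <= 1 ^ n) by (apply pow_incr; lra).
  rewrite pow1 in H. simpl. nra.
Qed.

Lemma psi_coef_bound (p : R) (n : nat) : 0 < p < 1 ->
  0 <= psi_coef p n <= / (1 - p).
Proof.
  intros Hp. assert (0 < / (1 - p)) by (apply Rinv_0_lt_compat; lra).
  destruct n as [|n]; [simpl; lra|].
  generalize (pow_S_lt_1 p n Hp). unfold psi_coef. intros [H1 H2].
  split; [apply Rlt_le, Rinv_0_lt_compat; lra|].
  apply Rinv_le_contravar; lra.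
Qed.

Lemma unit_disk_psi_coef (p : R) : 0 < p < 1 -> unit_disk (psi_coef p).
Proof.
  intros Hp. apply unit_disk_bounded with (/ (1 - p)). intros n.
  destruct (psi_coef_bound p n Hp). rewrite Rabs_pos_eq; lra.
Qed.

Lemma delta_coef_bound (p c : R) (n : nat) : 0 < p < 1 -> 0 < c ->
  0 <= delta_coef p c n <= / (1 - p).
Proof.
  intros Hp Hc. destruct (psi_coef_bound p n Hp).
  unfold delta_coef. destruct (Rpower_lt_1 p c Hp Hc).
  assert (0 <= Rpower p c ^ n) by (apply pow_le; lra).
  assert (Rpower p c ^ n <= 1 ^ n) by (apply pow_incr; lra).
  rewrite pow1 in *. nra.
Qed.

Lemma unit_disk_delta_coef (p c : R) : 0 < p < 1 -> 0 < c ->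
  unit_disk (delta_coef p c).
Proof.
  intros Hp Hc. apply unit_disk_bounded with (/ (1 - p)). intros n.
  destruct (delta_coef_bound p c n Hp Hc). rewrite Rabs_pos_eq; lra.
Qed.

(** This is [q_ratio_mul] at a = p^i, b = p^j. An index 0 would break the lower bound, as
    [delta_coef] vanishes there. *)
Lemma delta_coef_mul (p c : R) (i j : nat) : 0 < p < 1 -> 0 < c ->
  (1 <= i)%nat -> (1 <= j)%nat ->
  (c <= 1 -> c * delta_coef p c (i + j) <= delta_coef p c i * delta_coef p c j) /\
  (1 <= c -> delta_coef p c i * delta_coef p c j <= c * delta_coef p c (i + j)).
Proof.
  intros Hp Hc Hi Hj.
  assert (E : forall n, (1 <= n)%nat ->
    0 < p ^ n < 1 /\ delta_coef p c n = (1 - Rpower (p ^ n) c) / (1 - p ^ n)).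
  { intros [|n] Hn; [lia|]. split.
    - generalize (pow_S_lt_1 p n Hp). lra.
    - unfold delta_coef, psi_coef, Rdiv.
      rewrite <- !Rpower_pow by (try apply exp_pos; lra).
      rewrite !Rpower_mult, (Rmult_comm c). reflexivity. }
  destruct (E i Hi) as [Pi Ei], (E j Hj) as [Pj Ej], (E (i + j)%nat ltac:(lia)) as [_ Eij].
  rewrite Ei, Ej, Eij, pow_add. now apply q_ratio_mul.
Qed.

(** * Power sums *)

(* [i ^ j] for [i >= 1], but [0] at [i = 0] even when [j = 0]. *)
Definition pos_pow (j i : nat) : R := match i with O => 0 | S _ => INR i ^ j end.

(* [max (1, m - 1)] at [m = S j], i.e. the constant [d (S j) q] for [q < 1]. *)
Definition shift (j : nat) : R := match j with O => 1 | S _ => INR j end.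

(** Bernoulli's inequality (1 - 1/x)^k >= 1 - k/x, cleared of denominators. *)
Lemma bernoulli_pred (x : R) (k : nat) : 1 <= x ->
  x ^ k * (x - INR k) <= (x - 1) ^ k * x.
Proof.
  intros Hx. induction k as [|k IH]; [simpl; lra|].
  rewrite S_INR. simpl pow.
  assert (0 <= x ^ k) by (apply pow_le; lra).
  assert (H1 : (x - 1) * (x ^ k * (x - INR k)) <= (x - 1) * ((x - 1) ^ k * x))
    by (apply Rmult_le_compat_l; lra).
  assert (0 <= x ^ k * INR k) by (apply Rmult_le_pos; [lra|apply pos_INR]).
  nra.
Qed.

(** Induction on n. For j >= 1 and N = n + 1, adding the new term (j + 1) N^j to the bound N^j (N -
    j) gives N^j (N + 1), which is at least (N + 1)^j (N + 1 - j) by [bernoulli_pred]. For j = 0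
    both sides equal n. *)
Lemma sum_pos_pow_ge (j n : nat) :
  INR (S n) ^ j * (INR (S n) - shift j) <= INR (S j) * sum_f_R0 (pos_pow j) n.
Proof.
  induction n as [|n IH].
  - change (sum_f_R0 (pos_pow j) 0) with 0. change (INR 1) with 1.
    rewrite pow1. destruct j as [|j]; [simpl; lra|].
    unfold shift. rewrite S_INR. generalize (pos_INR j). lra.
  - rewrite tech5. change (pos_pow j (S n)) with (INR (S n) ^ j).
    destruct j as [|j].
    + simpl pow in *. unfold shift in *. rewrite !S_INR in *. simpl INR in *. lra.
    + unfold shift in *.
      assert (H := bernoulli_pred (INR (S (S n))) (S j)
                     ltac:(rewrite !S_INR; generalize (pos_INR n); lra)).
      replace (INR (S (S n)) - 1) with (INR (S n)) in H by (rewrite !S_INR; ring).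
      replace (INR (S (S j))) with (INR (S j) + 1) in * by (rewrite !S_INR; ring).
      replace (INR (S (S n))) with (INR (S n) + 1) in * by (rewrite !S_INR; ring).
      lra.
Qed.

(** The sums are n for j = 0 and n (n + 1) / 2 for j = 1. Equality here is what permits the reversed
    sign when c >= 1. *)
Lemma sum_pos_pow_low (j n : nat) : (j <= 1)%nat ->
  INR (S j) * sum_f_R0 (pos_pow j) n = INR (S n) ^ j * (INR (S n) - shift j).
Proof.
  intros Hj. induction n as [|n IH].
  - destruct j as [|[|j]]; [simpl; ring|simpl; ring|lia].
  - rewrite tech5, Rmult_plus_distr_l, IH. change (pos_pow j (S n)) with (INR (S n) ^ j).
    destruct j as [|[|j]]; [| |lia]; unfold shift; rewrite !S_INR; simpl; ring.
Qed.

(** * The Cauchy product and the signs of the coefficients of G *)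

Definition conv_coef (p c : R) (j : nat) : nat -> R :=
  PS_mult (fun n => INR n ^ j * delta_coef p c n) (delta_coef p c).

Lemma delta_coef_0 (p c : R) : delta_coef p c 0 = 0.
Proof. unfold delta_coef, psi_coef. ring. Qed.

(** Both end terms of the Cauchy product vanish because [delta_coef] is 0 at 0, hence [pos_pow] and
    the sum up to n. The others compare termwise by [delta_coef_mul], whose bound depends only on i
    + j. *)
Lemma conv_coef_bounds (p c : R) (j n : nat) : 0 < p < 1 -> 0 < c ->
  (c <= 1 -> c * delta_coef p c (S n) * sum_f_R0 (pos_pow j) n <= conv_coef p c j (S n)) /\
  (1 <= c -> conv_coef p c j (S n) <= c * delta_coef p c (S n) * sum_f_R0 (pos_pow j) n).
Proof.
  intros Hp Hc.
  assert (E : conv_coef p c j (S n) = sum_f_R0 (fun i =>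
     pos_pow j i * (delta_coef p c i * delta_coef p c (S n - i))) n).
  { unfold conv_coef, PS_mult. rewrite tech5, Nat.sub_diag, delta_coef_0, Rmult_0_r, Rplus_0_r.
    apply sum_eq. intros [|i] _; [rewrite delta_coef_0|unfold pos_pow]; ring. }
  assert (B : forall i, (i <= n)%nat ->
    (c <= 1 -> pos_pow j i * (c * delta_coef p c (S n)) <=
       pos_pow j i * (delta_coef p c i * delta_coef p c (S n - i))) /\
    (1 <= c -> pos_pow j i * (delta_coef p c i * delta_coef p c (S n - i)) <=
       pos_pow j i * (c * delta_coef p c (S n)))).
  { intros [|i] Hi; [simpl pos_pow; split; intros; lra|].
    destruct (delta_coef_mul p c (S i) (S n - S i) Hp Hc ltac:(lia) ltac:(lia)) as [H1 H2].
    replace (S i + (S n - S i))%nat with (S n) in * by lia.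
    assert (0 <= pos_pow j (S i)) by apply pow_le, pos_INR.
    split; intros Hc1; apply Rmult_le_compat_l; auto. }
  rewrite E, scal_sum.
  split; intros Hc1; apply sum_Rle; intros i Hi; now apply B.
Qed.

(* [G (S j) x q c] is [L ^ (j + 2) / c] times the power series with these
   coefficients at [p ^ x], where [p = min (q, 1 / q)] and [L = - ln p]. *)
Definition G_coef (p c : R) (j n : nat) : R :=
  INR (S j) / c * conv_coef p c j n - INR n ^ S j * delta_coef p c n
  + shift j * (INR n ^ j * delta_coef p c n).

Lemma G_coef_0 (p c : R) (j : nat) : G_coef p c j 0 = 0.
Proof.
  unfold G_coef, conv_coef, PS_mult. simpl sum_f_R0. rewrite !delta_coef_0. ring.
Qed.

Lemma G_coef_S (p c : R) (j n : nat) : G_coef p c j (S n) =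
  INR (S j) / c * conv_coef p c j (S n)
  - delta_coef p c (S n) * (INR (S n) ^ j * (INR (S n) - shift j)).
Proof. unfold G_coef. rewrite <- tech_pow_Rmult. ring. Qed.

(** The c of the convolution bound cancels 1 / c; what remains is [sum_pos_pow_ge] times the
    nonnegative [delta_coef]. *)
Lemma G_coef_ge_0 (p c : R) (j n : nat) : 0 < p < 1 -> 0 < c <= 1 ->
  0 <= G_coef p c j n.
Proof.
  intros Hp Hc. destruct n as [|n]; [rewrite G_coef_0; lra|].
  rewrite G_coef_S.
  destruct (conv_coef_bounds p c j n Hp ltac:(lra)) as [H _]. specialize (H ltac:(lra)).
  destruct (delta_coef_bound p c (S n) Hp ltac:(lra)) as [W _].
  assert (0 < INR (S j) / c) by (apply Rdiv_lt_0_compat; [apply lt_0_INR; lia|lra]).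
  apply Rmult_le_compat_l with (r := INR (S j) / c) in H; [|lra].
  replace (INR (S j) / c * (c * delta_coef p c (S n) * sum_f_R0 (pos_pow j) n))
    with (delta_coef p c (S n) * (INR (S j) * sum_f_R0 (pos_pow j) n)) in H
    by (field; lra).
  assert (K := Rmult_le_compat_l _ _ _ W (sum_pos_pow_ge j n)). lra.
Qed.

(** The upper convolution bound, after c cancels, matches the subtracted term exactly by
    [sum_pos_pow_low]. *)
Lemma G_coef_le_0 (p c : R) (j n : nat) : 0 < p < 1 -> 1 <= c -> (j <= 1)%nat ->
  G_coef p c j n <= 0.
Proof.
  intros Hp Hc Hj. destruct n as [|n]; [rewrite G_coef_0; lra|].
  rewrite G_coef_S, <- sum_pos_pow_low by exact Hj.
  destruct (conv_coef_bounds p c j n Hp ltac:(lra)) as [_ H]. specialize (H Hc).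
  assert (0 < INR (S j) / c) by (apply Rdiv_lt_0_compat; [apply lt_0_INR; lia|lra]).
  apply Rmult_le_compat_l with (r := INR (S j) / c) in H; [|lra].
  replace (INR (S j) / c * (c * delta_coef p c (S n) * sum_f_R0 (pos_pow j) n))
    with (delta_coef p c (S n) * (INR (S j) * sum_f_R0 (pos_pow j) n)) in H
    by (field; lra).
  lra.
Qed.

(** * The logarithmic series and the infinite product *)

Definition log_coef (p : R) (n : nat) : R := psi_coef p n / INR n.

Lemma mul_index_log_coef (p : R) (n : nat) : INR n * log_coef p n = psi_coef p n.
Proof.
  unfold log_coef. destruct n as [|n]; [simpl; ring|].
  field. apply not_0_INR. lia.
Qed.

Lemma unit_disk_log_coef (p : R) : 0 < p < 1 -> unit_disk (log_coef p).
Proof.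
  intros Hp. apply unit_disk_bounded with (/ (1 - p)). intros n.
  destruct (psi_coef_bound p n Hp) as [H0 H1]. unfold log_coef.
  destruct n as [|n].
  (* At index 0 the numerator is 0, so the division by [INR 0] yields 0. *)
  { unfold psi_coef, Rdiv. rewrite Rmult_0_l, Rabs_R0. lra. }
  assert (1 <= INR (S n)) by (rewrite S_INR; generalize (pos_INR n); lra).
  rewrite Rabs_pos_eq by (apply Rdiv_le_0_compat; lra).
  apply Rle_div_l; nra.
Qed.

(** The difference has coefficients 1 / n, so its derivative is the geometric series 1 / (1 - y);
    adding ln (1 - y) gives a function with zero derivative and value 0 at 0. *)
Lemma log_series_step (p z : R) : 0 < p < 1 -> 0 < z < 1 ->
  PSeries (log_coef p) z - PSeries (log_coef p) (p * z) = - ln (1 - z).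
Proof.
  intros Hp Hz.
  set (b := PS_plus (log_coef p) (PS_scal (-1) (fun n => p ^ n * log_coef p n))).
  assert (Bn : forall n, b n = log_coef p n * (1 - p ^ n)).
  { intros n. unfold b, PS_plus, PS_scal, plus, scal; simpl; unfold mult; simpl. ring. }
  assert (Hd : unit_disk (log_coef p)) by now apply unit_disk_log_coef.
  assert (Hd' : unit_disk (fun n => p ^ n * log_coef p n)).
  { intros y Hy. apply ex_pseries_R.
    apply ex_series_ext with (fun n => log_coef p n * (p * y) ^ n).
    - intros n. rewrite Rpow_mult_distr. simpl. ring.
    - apply ex_pseries_R, Hd. rewrite Rabs_mult, (Rabs_pos_eq p) by lra.
      generalize (Rabs_pos y). nra. }
  assert (Hb : unit_disk b) by (apply unit_disk_plus, unit_disk_scal; assumption).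
  assert (Eb : forall y, Rabs y < 1 ->
    PSeries b y = PSeries (log_coef p) y - PSeries (log_coef p) (p * y)).
  { intros y Hy. unfold b. rewrite PSeries_plus, PSeries_scal, (PSeries_mul_var _ p y).
    - ring.
    - now apply Hd.
    - now apply unit_disk_scal. }
  rewrite <- Eb by (rewrite Rabs_pos_eq; lra).
  assert (E : PSeries b 0 + ln (1 - 0) = PSeries b z + ln (1 - z)).
  { apply (eq_is_derive (V := R_NormedModule) (fun y => PSeries b y + ln (1 - y))); [|lra].
    intros y Hy.
    assert (Ay : Rabs y < 1) by (rewrite Rabs_pos_eq; lra).
    change (is_derive (fun y => PSeries b y + ln (1 - y)) y 0).
    replace 0 with (/ (1 - y) + - / (1 - y)) by ring.
    apply (is_derive_plus (PSeries b) (fun y => ln (1 - y))).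
    - replace (/ (1 - y)) with (PSeries (PS_derive b) y).
      + apply is_derive_PSeries. now apply unit_disk_lt_radius.
      + rewrite <- Series_geom by exact Ay. apply Series_ext. intros n.
        replace (PS_derive b n) with 1; [ring|].
        unfold PS_derive. rewrite Bn. unfold log_coef, psi_coef.
        generalize (pow_S_lt_1 p n Hp); intros Hn.
        field. split; [lra|apply not_0_INR; lia].
    - auto_derive; [lra|]. field. lra. }
  rewrite PSeries_0, Rminus_0_r, ln_1 in E.
  replace (b 0%nat) with 0 in E.
  - lra.
  - rewrite Bn. simpl. ring.
Qed.

Lemma exp_log_series_step (p z : R) : 0 < p < 1 -> 0 < z < 1 ->
  1 - z = exp (PSeries (log_coef p) (p * z) - PSeries (log_coef p) z).
Proof.
  intros Hp Hz.
  replace (PSeries _ _ - PSeries _ _) with (ln (1 - z))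
    by (generalize (log_series_step p z Hp Hz); lra).
  rewrite exp_ln; lra.
Qed.

(** By [exp_log_series_step] at p^n p and p^n p^x every factor is an exponential, and the exponents
    telescope. The product includes index N, whence p^(N + 1). *)
Lemma prod_q_pochhammer_ratio (p x : R) (N : nat) : 0 < p < 1 -> 0 < x ->
  prod_f_R0 (fun n =>
    (1 - Rpower p (INR n + 1)) / (1 - Rpower p (INR n + x))) N =
  exp (PSeries (log_coef p) (Rpower p x) - PSeries (log_coef p) p
       + PSeries (log_coef p) (p ^ S N * p)
       - PSeries (log_coef p) (p ^ S N * Rpower p x)).
Proof.
  intros Hp Hx.
  destruct (Rpower_lt_1 p x Hp Hx) as [Z0 Z1]. set (z := Rpower p x) in *.
  assert (T : forall n, (1 - Rpower p (INR n + 1)) / (1 - Rpower p (INR n + x)) =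
    exp (PSeries (log_coef p) (p ^ S n * p) - PSeries (log_coef p) (p ^ n * p)
       + PSeries (log_coef p) (p ^ n * z) - PSeries (log_coef p) (p ^ S n * z))).
  { intros n. rewrite !Rpower_plus, Rpower_1, Rpower_pow by lra. fold z.
    assert (P : 0 < p ^ n <= 1).
    { split; [apply pow_lt; lra|]. rewrite <- (pow1 n). apply pow_incr; lra. }
    rewrite (exp_log_series_step p (p ^ n * p)) by nra.
    rewrite (exp_log_series_step p (p ^ n * z)) by nra.
    unfold Rdiv. rewrite <- exp_Ropp, <- exp_plus. f_equal.
    simpl pow. rewrite !Rmult_assoc. ring. }
  induction N as [|N IH].
  - etransitivity; [exact (T 0%nat)|]. f_equal.
    simpl pow. rewrite !Rmult_1_l. ring.
  - etransitivity; [exact (f_equal2 Rmult IH (T (S N)))|].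
    rewrite <- exp_plus. f_equal. ring.
Qed.

(** The two tails of the telescoped exponent tend to the value of the series at 0, which is 0. *)
Lemma infinite_product_q_pochhammer_ratio (p x : R) : 0 < p < 1 -> 0 < x ->
  infinite_product (fun n =>
    (1 - Rpower p (INR n + 1)) / (1 - Rpower p (INR n + x))) =
  exp (PSeries (log_coef p) (Rpower p x) - PSeries (log_coef p) p).
Proof.
  intros Hp Hx. unfold infinite_product.
  assert (S0 : forall z, is_lim_seq (fun N => PSeries (log_coef p) (p ^ S N * z)) 0).
  { intros z. replace 0 with (PSeries (log_coef p) 0).
    - apply is_lim_seq_continuous.
      + apply PSeries_continuity. apply unit_disk_lt_radius; [now apply unit_disk_log_coef|].
        rewrite Rabs_R0. lra.
      + replace 0 with (0 * z) by ring.
        apply (is_lim_seq_scal_r (fun N => p ^ S N) z 0).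
        apply (is_lim_seq_incr_1 (fun N => p ^ N)), is_lim_seq_geom.
        rewrite Rabs_pos_eq; lra.
    - rewrite PSeries_0. unfold log_coef, psi_coef, Rdiv. ring. }
  set (A := _ - _).
  rewrite (is_lim_seq_unique _ (exp A)); [reflexivity|].
  eapply is_lim_seq_ext; [intros N; symmetry; now apply prod_q_pochhammer_ratio|].
  apply is_lim_seq_continuous; [apply derivable_continuous_pt, derivable_pt_exp|].
  replace (Finite A) with (Finite (A + 0 - 0)) by (f_equal; ring).
  apply is_lim_seq_minus'; [apply is_lim_seq_plus'; [apply is_lim_seq_const|]|]; apply S0.
Qed.

(** * Expansion of psi and of its differences, for both ranges of q *)

Definition base (q : R) : R := if Rlt_dec q 1 then q else / q.

Lemma base_bound (q : R) : 0 < q -> q <> 1 -> 0 < base q < 1.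
Proof.
  intros H0 H1. unfold base. destruct (Rlt_dec q 1) as [H|H]; [lra|].
  split; [apply Rinv_0_lt_compat; lra|].
  rewrite <- Rinv_1. apply Rinv_lt_contravar; lra.
Qed.

(** For q > 1 the factor q^(x (x - 1) / 2) adds (x - 1/2) ln q to psi; this is the coefficient of
    x. *)
Definition psi_slope (q : R) : R := if Rlt_dec q 1 then 0 else ln q.

Lemma Rpower_inv_base (q x : R) : 0 < q -> Rpower q (- x) = Rpower (/ q) x.
Proof. intros Hq. unfold Rpower. rewrite ln_Rinv by lra. f_equal. ring. Qed.

(** Differentiate the logarithm of the closed form of the product. The constant stays existential
    because [Delta] and derivatives remove it. *)
Lemma psi_expansion (q : R) : 0 < q -> q <> 1 -> exists B, forall x, 0 < x ->
  psi q x = B + psi_slope q * x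
    + ln (base q) * PSeries (psi_coef (base q)) (Rpower (base q) x).
Proof.
  intros Hq Hq1. assert (Hp := base_bound q Hq Hq1). set (p := base q) in *.
  (* The first term comes from the power with exponent 1 - x, the second from the quadratic
     exponent; the absolute value serves both ranges of q. *)
  exists (- ln (Rabs (1 - q)) - psi_slope q / 2). intros x Hx.
  assert (E : forall y, 0 < y -> ln (q_gamma q y) =
    (1 - y) * ln (Rabs (1 - q)) + psi_slope q * (1 / 2 * y * (y - 1))
    + (PSeries (log_coef p) (Rpower p y) - PSeries (log_coef p) p)).
  { intros y Hy. unfold q_gamma, psi_slope, p, base in *.
    destruct (Rlt_dec q 1) as [H|H].
    - rewrite infinite_product_q_pochhammer_ratio by (try exact Hp; exact Hy).
      rewrite ln_mult by apply exp_pos.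
      rewrite ln_Rpower, ln_exp, Rabs_pos_eq by lra. ring.
    (* Each q^(-t) is (1/q)^t, so the product for q > 1 is the one with base 1/q. *)
    - replace (infinite_product _) with (infinite_product (fun n =>
        (1 - Rpower (/ q) (INR n + 1)) / (1 - Rpower (/ q) (INR n + y)))).
      + rewrite infinite_product_q_pochhammer_ratio by (try exact Hp; exact Hy).
        rewrite !ln_mult by (try apply Rmult_lt_0_compat; apply exp_pos).
        rewrite !ln_Rpower, ln_exp, Rabs_left by lra.
        replace (- (1 - q)) with (q - 1) by ring. ring.
      + unfold infinite_product. f_equal. apply Lim_seq_ext. intros N.
        induction N as [|N IH]; simpl prod_f_R0; [|rewrite IH];
          rewrite !Rpower_inv_base by lra; reflexivity. }
  unfold psi. apply is_derive_unique.
  eapply is_derive_ext_loc.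
  { apply (locally_pos x); [exact Hx|]. intros y Hy. symmetry. apply (E y Hy). }
  rewrite <- (PSeries_ext _ _ _ (mul_index_log_coef p)).
  apply (is_derive_plus
    (fun y => (1 - y) * ln (Rabs (1 - q)) + psi_slope q * (1 / 2 * y * (y - 1)))
    (fun y => PSeries (log_coef p) (Rpower p y) - PSeries (log_coef p) p)).
  - auto_derive; [exact I|]. field.
  - replace (ln p * _) with
      (minus (ln p * PSeries (fun n => INR n * log_coef p n) (Rpower p x)) 0)
      by (unfold minus, plus, opp; simpl; ring).
    apply (is_derive_minus (fun y => PSeries (log_coef p) (Rpower p y))
      (fun _ => PSeries (log_coef p) p)).
    + apply is_derive_PSeries_Rpower; [now apply unit_disk_log_coef|exact Hp|exact Hx].
    + apply (is_derive_const (K := R_AbsRing) (V := R_NormedModule)).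
Qed.

(** The linear part of psi leaves its slope for j = 0 and nothing for j >= 1. In the series, p^(x +
    c) = p^c p^x turns the difference into - [delta_coef]. *)
Lemma Delta_psi_pred (q c x : R) (j : nat) :
  0 < q -> q <> 1 -> 0 < c -> 0 < x ->
  Delta (psi_pred q (S j)) x c =
  (match j with O => psi_slope q | S _ => 0 end)
  - ln (base q) ^ S j / c *
    PSeries (fun n => INR n ^ j * delta_coef (base q) c n) (Rpower (base q) x).
Proof.
  intros Hq Hq1 Hc Hx. assert (Hp := base_bound q Hq Hq1).
  destruct (psi_expansion q Hq Hq1) as [B HB].
  set (p := base q) in *. set (e := psi_slope q) in *.
  assert (D : forall y, 0 < y -> Derive_n (psi q) j y =
    match j with O => B + e * y | 1%nat => e | _ => 0 end
    + ln p ^ S j * PSeries (fun n => INR n ^ j * psi_coef p n) (Rpower p y)).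
  { induction j as [|j IH]; intros y Hy.
    - simpl Derive_n. rewrite (HB y Hy), pow_1. do 2 f_equal.
      apply PSeries_ext. intros n. ring.
    - simpl Derive_n. apply is_derive_unique.
      eapply is_derive_ext_loc.
      { apply (locally_pos y); [exact Hy|]. intros u Hu. symmetry. apply (IH u Hu). }
      apply (is_derive_plus
        (fun u => match j with O => B + e * u | 1%nat => e | _ => 0 end)
        (fun u => ln p ^ S j * PSeries (fun n => INR n ^ j * psi_coef p n) (Rpower p u))).
      + destruct j as [|[|j]]; auto_derive; try exact I; ring.
      + rewrite (PSeries_ext _ (fun n => INR n * (INR n ^ j * psi_coef p n)))
          by (intros n; simpl; ring).
        replace (ln p ^ S (S j)) with (ln p ^ S j * ln p) by (simpl; ring).
        rewrite Rmult_assoc. apply is_derive_scal.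
        apply is_derive_PSeries_Rpower; [|exact Hp|exact Hy].
        now apply unit_disk_mul_index_pow, unit_disk_psi_coef. }
  assert (Hz := Rabs_Rpower_lt_1 p x Hp Hx).
  assert (Hv : ex_pseries (fun n => INR n ^ j * psi_coef p n) (Rpower p x))
    by now apply (unit_disk_mul_index_pow _ j (unit_disk_psi_coef p Hp)).
  assert (Hw : ex_pseries (fun n => INR n ^ j * delta_coef p c n) (Rpower p x))
    by now apply (unit_disk_mul_index_pow _ j (unit_disk_delta_coef p c Hp Hc)).
  assert (Q : PSeries (fun n => INR n ^ j * delta_coef p c n) (Rpower p x) =
    PSeries (fun n => INR n ^ j * psi_coef p n) (Rpower p x) -
    PSeries (fun n => INR n ^ j * psi_coef p n) (Rpower p (x + c))).
  { rewrite Rpower_plus, Rmult_comm, PSeries_mul_var.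
    assert (X : PSeries (fun n => Rpower p c ^ n * (INR n ^ j * psi_coef p n)) (Rpower p x) =
      PSeries (PS_minus (fun n => INR n ^ j * psi_coef p n)
                        (fun n => INR n ^ j * delta_coef p c n)) (Rpower p x)).
    { apply PSeries_ext. intros n. unfold PS_minus, PS_plus, PS_opp, delta_coef.
      unfold plus, opp; simpl. ring. }
    rewrite X, PSeries_minus by assumption. ring. }
  unfold Delta, psi_pred. rewrite (D x Hx), (D (x + c)) by lra. rewrite Q.
  destruct j as [|[|j]]; field; lra.
Qed.

(** * Expansion of G as a power series in p^x *)

Lemma alpha_Sm_m_1_0 (j : nat) : alpha (S j + 1) (S j) 1 0 = / INR (S j).
Proof.
  unfold alpha. rewrite Nat.add_1_r. simpl pred.
  change (fact (S j)) with (S j * fact j)%nat. rewrite mult_INR.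
  change (INR (fact 0)) with 1. field.
  split; [apply not_0_INR; lia|apply INR_fact_neq_0].
Qed.

(** The power [INR n ^ 0] is kept so that the factor has the form given by [Delta_psi_pred] at j =
    0. *)
Lemma G_coef_PSeries (p c z : R) (j : nat) : 0 < p < 1 -> 0 < c -> Rabs z < 1 ->
  PSeries (G_coef p c j) z =
  INR (S j) / c * (PSeries (fun n => INR n ^ j * delta_coef p c n) z *
                   PSeries (fun n => INR n ^ 0 * delta_coef p c n) z)
  - PSeries (fun n => INR n ^ S j * delta_coef p c n) z
  + shift j * PSeries (fun n => INR n ^ j * delta_coef p c n) z /\
  ex_pseries (G_coef p c j) z.
Proof.
  intros Hp Hc Hz.
  assert (U := unit_disk_delta_coef p c Hp Hc).
  assert (Uj := fun i => unit_disk_mul_index_pow _ i U).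
  assert (Ug : unit_disk (conv_coef p c j)) by now apply unit_disk_mult.
  assert (E : forall n, PS_plus (PS_plus (PS_scal (INR (S j) / c) (conv_coef p c j))
      (PS_scal (-1) (fun n => INR n ^ S j * delta_coef p c n)))
      (PS_scal (shift j) (fun n => INR n ^ j * delta_coef p c n)) n = G_coef p c j n).
  { intros n. unfold PS_plus, PS_scal, G_coef, plus, scal; simpl.
    unfold mult; simpl. ring. }
  assert (X1 := unit_disk_scal (INR (S j) / c) _ Ug).
  assert (X2 := unit_disk_scal (-1) _ (Uj (S j))).
  assert (X3 := unit_disk_scal (shift j) _ (Uj j)).
  split.
  - rewrite <- (PSeries_ext _ _ _ E).
    rewrite PSeries_plus; [|exact (unit_disk_plus _ _ X1 X2 z Hz)|exact (X3 z Hz)].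
    rewrite PSeries_plus; [|exact (X1 z Hz)|exact (X2 z Hz)].
    rewrite 3!PSeries_scal. unfold conv_coef.
    rewrite PSeries_mult; [|exact (unit_disk_lt_radius _ z (Uj j) Hz)
                           |exact (unit_disk_lt_radius _ z U Hz)].
    rewrite (PSeries_ext (fun n => INR n ^ 0 * delta_coef p c n) (delta_coef p c) z)
      by (intros n; simpl; ring).
    ring.
  - apply (unit_disk_ext _ _ E); [|exact Hz].
    exact (unit_disk_plus _ _ (unit_disk_plus _ _ X1 X2) X3).
Qed.

(** Both ranges of q give the same linear term. For m >= 2 its factor is (m - 1) L: from - d ln q if
    q < 1, and from m L (slope of psi) minus L (from d ln q) if q > 1. For m = 1, with X the series
    part of Delta psi, both give X (X + L). *)
Lemma G_expansion (q c x : R) (j : nat) :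
  0 < q -> q <> 1 -> 0 < c -> 0 < x ->
  G (S j) x q c = PSeries (PS_scal ((- ln (base q)) ^ S (S j) / c)
    (G_coef (base q) c j)) (Rpower (base q) x).
Proof.
  intros Hq Hq1 Hc Hx. assert (Hp := base_bound q Hq Hq1).
  rewrite PSeries_scal.
  destruct (G_coef_PSeries (base q) c (Rpower (base q) x) j Hp Hc
    (Rabs_Rpower_lt_1 _ _ Hp Hx)) as [-> _].
  (* The factor m of [G] cancels [alpha], leaving weight 1 on the difference of psi^(m). *)
  unfold G, F. rewrite alpha_Sm_m_1_0.
  replace (S j + 1)%nat with (S (S j)) by lia.
  rewrite !Delta_psi_pred by assumption.
  replace (Delta (psi_pred q 0) x c) with (-1)
    by (unfold Delta, psi_pred; field; lra).
  rewrite Nat.add_0_r.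
  set (W := PSeries (fun n => INR n ^ j * _) _).
  set (W0 := PSeries (fun n => INR n ^ 0 * _) _).
  set (W1 := PSeries (fun n => INR n ^ S j * _) _).
  (* For m = 1 the two factors are the same series; this must be recorded before the bodies are
     cleared. *)
  assert (HW : j = 0%nat -> W = W0) by (intros E; unfold W; rewrite E; reflexivity).
  clearbody W W0 W1.
  set (L := - ln (base q)).
  assert (Cases : (psi_slope q = 0 /\ ln q = - L /\ d (S j) q = shift j) \/
    (psi_slope q = L /\ ln q = L /\ d (S j) q = 1)).
  { unfold psi_slope, L, base, d. destruct (Rlt_dec q 1) as [H|H].
    - left. repeat split; [ring|]. destruct j as [|j]; [reflexivity|].
      destruct (le_dec 2 (S (S j))); [|lia].
      unfold shift. rewrite (S_INR (S j)). ring.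
    - right. rewrite ln_Rinv by lra. repeat split; ring. }
  assert (C : forall k, ln (base q) ^ S k = - ((-1) ^ k * L ^ S k)).
  { intros k. replace (ln (base q)) with (-1 * L) by (unfold L; ring).
    rewrite Rpow_mult_distr, <- (tech_pow_Rmult (-1)). ring. }
  rewrite !C. clearbody L.
  assert (Ss : (-1) ^ j * (-1) ^ j = 1).
  { rewrite <- Rpow_mult_distr. replace (-1 * -1) with 1 by ring. apply pow1. }
  (* For j >= 1 every term on the left carries (-1)^j twice. Giving the right side the same square
     lets (-1)^j become a variable [s] for [field]; [S0] keeps its value at j = 0. *)
  rewrite <- (Rmult_1_l (L ^ S (S j) / c * _)), <- Ss.
  rewrite <- !tech_pow_Rmult, !pow_O.
  assert (S0 : j = 0%nat -> (-1) ^ j = 1) by (intros ->; reflexivity).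
  revert S0. generalize ((-1) ^ j). intros s S0.
  assert (Hm : INR (S j) <> 0) by (apply not_0_INR; lia).
  destruct Cases as [[-> [-> ->]]|[-> [-> ->]]]; destruct j as [|j].
  - rewrite HW, S0 by reflexivity. simpl. field. lra.
  - unfold shift. field. lra.
  - rewrite HW, S0 by reflexivity. simpl. field. lra.
  - unfold shift. rewrite (S_INR (S j)) in *. field. lra.
Qed.

(** * Complete monotonicity from the signs of the coefficients *)

Theorem theorem1p1 (q : R) (m : nat)
  (q_pos : 0 < q) (q_neq1 : q <> 1) (m_pos : (1 <= m)%nat) :
  (forall c : R, 0 < c < 1 ->
     completely_monotonic 0 p_infty (fun x => G m x q c)) /\
  (m = 1%nat \/ m = 2%nat -> forall c : R, 1 < c ->
     completely_monotonic 0 p_infty (fun x => - G m x q c)).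
Proof.
  assert (Hp := base_bound q q_pos q_neq1).
  destruct m as [|j]; [lia|].
  assert (HU : forall c r, 0 < c -> unit_disk (PS_scal r (G_coef (base q) c j))).
  { intros c r Hc. apply unit_disk_scal. intros z Hz. now apply G_coef_PSeries. }
  assert (HK : forall c, 0 < c -> 0 < (- ln (base q)) ^ S (S j) / c).
  { intros c Hc. apply Rdiv_lt_0_compat; [|exact Hc]. apply pow_lt.
    assert (ln (base q) < 0) by (rewrite <- ln_1; apply ln_increasing; lra). lra. }
  split.
  - intros c Hc.
    apply completely_monotonic_PSeries_Rpower with (2 := Hp)
      (a := PS_scal ((- ln (base q)) ^ S (S j) / c) (G_coef (base q) c j)).
    + apply HU. lra.
    + intros n. apply Rmult_le_pos.
      * apply Rlt_le, HK. lra.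
      * apply G_coef_ge_0; lra.
    + intros x Hx. apply G_expansion; lra.
  - intros Hm c Hc.
    apply completely_monotonic_PSeries_Rpower with (2 := Hp)
      (a := PS_scal (- ((- ln (base q)) ^ S (S j) / c)) (G_coef (base q) c j)).
    + apply HU. lra.
    + intros n. assert (H1 := HK c ltac:(lra)).
      assert (H2 := G_coef_le_0 (base q) c j n Hp ltac:(lra) ltac:(lia)).
      change (0 <= - ((- ln (base q)) ^ S (S j) / c) * G_coef (base q) c j n). nra.
    + intros x Hx. rewrite G_expansion, !PSeries_scal by lra. ring.
Qed.
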